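(* Let $\beta\in(0,1]$, $\delta^\star\in(0,1)$, and let $\hat{\mathbf{Y}}_1(\mathbf{P}),\dots,\hat{\mathbf{Y}}_\nu(\mathbf{P})$ be the i.i.d. positive semidefinite sketches defined in the context, with $s<c<\frac{8s}{3\nu\beta}\log\bigl(\frac{2s}{\delta^\star}\bigr)$ and $\mathrm{rank}(\hat{\mathbf{Y}}_t(\mathbf{P}))\le r$ for all $t$. Then for $\bar{\mathbf{Y}}(\mathbf{P})=\frac1\nu\sum_{t=1}^\nu\hat{\mathbf{Y}}_t(\mathbf{P})$ we have $$\mathrm{rank}\bigl(\bar{\mathbf{Y}}(\mathbf{P})\bigr)\le\min\{s,\nu r\}.$$ If $\nu r<s$, then $\bar{\mathbf{Y}}(\mathbf{P})$ is singular with probability $1$. Conversely, $\bar{\mathbf{Y}}(\mathbf{P})\succ0$ if the union of the sampled indices across the $\nu$ sketches contains some fixed spanning set $J_\star\subset\{1,\dots,N\}$ of dimension $s$, in which case $$\mathbb{P}\bigl(\bar{\mathbf{Y}}(\mathbf{P})\succ0\bigr)\ge\prod_{i\in J_\star}\bigl(1-(1-\eta_i)^\nu\bigr)\ge1-\sum_{i\in J_\star}(1-\eta_i)^\nu.$$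
   Context: $\mathbf{P}\in\mathbb{R}^{N\times N}$ is a diagonal matrix with positive diagonal entries and $\mathbf{U}\in\mathbb{R}^{N\times s}$ ($N>s$) has orthonormal columns, with rows $\mathbf{u}_{(i)}$. The leverage scores are $\ell_i(\mathbf{U})=\|\mathbf{u}_{(i)}\|^2$, $\xi_i(\mathbf{U})=s^{-1}\ell_i(\mathbf{U})$, and for a positive integer $c$, $\eta_i=\min\{1,c\,\xi_i(\mathbf{U})\}>0$ for all $i$. For $t=1,\dots,\nu$, $i=1,\dots,N$, $\gamma_i^{(t)}$ are independent Bernoulli variables with $\mathbb{P}(\gamma_i^{(t)}=1)=\eta_i$, $\mathbf{S}_t=\mathrm{diag}\bigl(\gamma_1^{(t)}/\sqrt{\eta_1},\dots,\gamma_N^{(t)}/\sqrt{\eta_N}\bigr)$, and $\hat{\mathbf{Y}}_t(\mathbf{P})=(\mathbf{S}_t\mathbf{P}^{1/2}\mathbf{U})^\top(\mathbf{S}_t\mathbf{P}^{1/2}\mathbf{U})$. The constant $\beta$ is such that $\xi_i(\mathbf{U})\ge\beta\,\xi_i(\mathbf{U}_y)$ for all $i$, where $\mathbf{P}^{1/2}\mathbf{U}=\mathbf{U}_y\boldsymbol{\Sigma}_y\mathbf{V}_y^\top$ is a thin SVD and $\xi_i(\mathbf{U}_y)=s^{-1}\|(\mathbf{u}_y)_{(i)}\|^2$. Index $i$ is sampled in sketch $t$ if $\gamma_i^{(t)}=1$. A spanning set $J_\star$ of dimension $s$ is an index set for which the rows $\{\mathbf{u}_{(i)}:i\in J_\star\}$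 span $\mathbb{R}^s$. $\mathbf{A}\succ0$ means symmetric positive definite. *)

(* Defs.v *)
From HB Require Import structures.
From mathcomp Require Export all_boot all_order all_algebra.
From mathcomp Require Export all_classical all_reals all_analysis.

Set Implicit Arguments.
Unset Strict Implicit.
Unset Printing Implicit Defensive.

Import Order.TTheory GRing.Theory Num.Theory.

Local Open Scope classical_set_scope.
Local Open Scope ring_scope.

Section LinearAlgebra.
Context {R : realType}.

(* The sum of squares is written out because the library norm `|row i U| on
   matrices is the sup norm. *)
Definition leverage N s (U : 'M[R]_(N, s)) (i : 'I_N) : R :=
  \sum_(j < s) U i j ^+ 2.

Definition normalized_leverage N s (U : 'M[R]_(N, s)) (i : 'I_N) : R :=
  s%:R^-1 * leverage U i.

Definition orthonormal_columns N s (U : 'M[R]_(N, s)) : Prop :=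
  U^T *m U = 1%:M.

Definition pos_diag_mx N (D : 'M[R]_N) : Prop :=
  is_diag_mx D /\ forall i, 0 < D i i.

(* Square root of a diagonal matrix only; off-diagonal entries are ignored. *)
Definition sqrt_diag_mx N (D : 'M[R]_N) : 'M[R]_N :=
  diag_mx (\row_i Num.sqrt (D i i)).

(* No order is imposed on the singular values: the row norms of the left
   factor, the only data used here, do not depend on it. *)
Definition thin_svd N s (M : 'M[R]_(N, s)) (Uy : 'M[R]_(N, s))
    (Sigma V : 'M[R]_s) : Prop :=
  [/\ orthonormal_columns Uy, V^T *m V = 1%:M,
      is_diag_mx Sigma, forall i, 0 <= Sigma i i
    & M = Uy *m Sigma *m V^T].

Definition posdefmx n (A : 'M[R]_n) : Prop :=
  A^T = A /\ forall x : 'cV[R]_n, x != 0 -> 0 < (x^T *m A *m x) 0 0.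

Definition spanning_rows N s (U : 'M[R]_(N, s)) (J : {set 'I_N}) : Prop :=
  row_full (\sum_(i in J) <<row i U>>)%MS.

Definition sampling_prob N s (U : 'M[R]_(N, s)) (c : nat) (i : 'I_N) : R :=
  Num.min 1 (c%:R * normalized_leverage U i).

Definition sampling_mx N (eta : 'I_N -> R) (g : 'I_N -> bool) : 'M[R]_N :=
  diag_mx (\row_i ((g i)%:R / Num.sqrt (eta i))).

Definition sketch N s (P : 'M[R]_N) (U : 'M[R]_(N, s)) (eta : 'I_N -> R)
    (g : 'I_N -> bool) : 'M[R]_s :=
  let M := sampling_mx eta g *m sqrt_diag_mx P *m U in M^T *m M.

Definition mean_sketch N s nu (P : 'M[R]_N) (U : 'M[R]_(N, s))
    (eta : 'I_N -> R) (g : 'I_nu -> 'I_N -> bool) : 'M[R]_s :=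
  nu%:R^-1 *: \sum_(t < nu) sketch P U eta (g t).

End LinearAlgebra.

Definition sampled_indices N nu (g : 'I_nu -> 'I_N -> bool) : {set 'I_N} :=
  [set i | [exists t, g t i]]%SET.

Definition mutually_independent d (Omega : measurableType d) (R : realType)
    (Pr : probability Omega R) d' (T : measurableType d') (I : finType)
    (X : I -> Omega -> T) : Prop :=
  forall (A : {set I}) (B : I -> set T), (forall k, measurable (B k)) ->
    Pr (\bigcap_(k in [set` A]) (X k @^-1` B k)) =
    (\prod_(k in A) Pr (X k @^-1` B k))%E.

(* Main.v *)
(** The quadratic form of the averaged sketch at [x] is a nonnegative combination
    of the squares [(U x)_i ^ 2] with positive weight exactly on the sampled [i], so
    it vanishes only if [U x] vanishes on the sampled rows; if these contain a
    spanning set, [x = 0].  Index [i] is missed by all sketches with probability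
    [(1 - eta_i) ^ nu], the events "[i] is missed" obey the product rule, and this
    rule passes to their complements.  Events depending on the finitely many
    Bernoulli variables are automatically measurable. *)
Require Import Defs.
From mathcomp Require Import all_boot all_order all_algebra.
From mathcomp Require Import all_classical all_reals all_analysis.
From mathcomp Require Import ring lra.

Import Order.TTheory GRing.Theory Num.Theory.

Local Open Scope classical_set_scope.
Local Open Scope ring_scope.

Set Implicit Arguments.
Unset Strict Implicit.

Lemma quadratic_form_gram (R : comPzRingType) m n (M : 'M[R]_(m, n))
    (x : 'cV[R]_n) :
  (x^T *m (M^T *m M) *m x) 0 0 = \sum_i ((M *m x) i 0) ^+ 2.
Proof.
rewrite mulmxA -mulmxA -trmx_mul mxE.
by apply: eq_bigr => i _; rewrite mxE expr2.
Qed.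

Lemma mxrank_sum_le (F : fieldType) (I : finType) m n (A : I -> 'M[F]_(m, n)) :
  (\rank (\sum_i A i)%R <= \sum_i \rank (A i))%N.
Proof.
apply: (big_ind2 (fun (B : 'M[F]_(m, n)) k => (\rank B <= k)%N)) => //.
  by rewrite mxrank0.
move=> B k C l leBk leCl; apply: leq_trans (leq_add leBk leCl).
exact: leq_trans (mxrankS (addmx_sub_adds (submx_refl B) (submx_refl C)))
  (mxrank_adds_leqif B C).
Qed.

(** The Weierstrass product inequality, the algebraic form of a union bound. *)
Lemma prod_one_sub_ge (R : realDomainType) (I : finType) (A : {set I})
    (x : I -> R) : (forall i, 0 <= x i <= 1) ->
  1 - \sum_(i in A) x i <= \prod_(i in A) (1 - x i).
Proof.
move=> x01.
suff [] : 1 - \sum_(i in A) x i <= \prod_(i in A) (1 - x i) /\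
    0 <= \prod_(i in A) (1 - x i) <= 1 by [].
(* The bounds on [b] are carried along because combining two factors uses [(1 - b) * (1 - b') >= 0],
   that is [b + b' - 1 <= b * b']. *)
apply: (big_ind2 (fun a b : R => 1 - a <= b /\ 0 <= b <= 1)).
- by rewrite subr0 !lexx ler01.
- move=> a b a' b' [ab /andP[b0 b1]] [ab' /andP[b'0 b'1]].
  rewrite mulr_ge0 // mulr_ile1 //; split=> //.
  have := mulr_ge0 (_ : 0 <= 1 - b) (_ : 0 <= 1 - b'); rewrite !subr_ge0.
  by move=> /(_ b1 b'1); lra.
- by move=> i _; have := x01 i; lra.
Qed.

(** The row vectors annihilating [x] form the subspace [kermx x]; it contains a spanning family,
    hence the identity, and [1%:M *m x = 0]. *)
Lemma spanning_rows_inj (R : realType) N s (U : 'M[R]_(N, s)) (J : {set 'I_N})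
    (x : 'cV[R]_s) : spanning_rows U J ->
  (forall i, i \in J -> (U *m x) i 0 = 0) -> x = 0.
Proof.
move=> fullJ Ux0; rewrite -[x]mul1mx; apply/sub_kermxP.
have span1 : (1%:M <= \sum_(i in J) <<row i U>>)%MS by rewrite sub1mx.
apply: submx_trans span1 _ => /=.
apply/sumsmx_subP => i iJ; rewrite genmxE; apply/sub_kermxP.
by rewrite -row_mul; apply/rowP => j; rewrite ord1 [LHS]mxE Ux0 // mxE.
Qed.

Section Sketch.
Context {R : realType} {N s nu : nat}.
Variables (P : 'M[R]_N) (U : 'M[R]_(N, s)) (eta : 'I_N -> R).

Lemma sketch_form (g : 'I_N -> bool) (x : 'cV[R]_s) :
  (x^T *m sketch P U eta g *m x) 0 0 =
  \sum_i ((g i)%:R / Num.sqrt (eta i) * Num.sqrt (P i i) * (U *m x) i 0) ^+ 2.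
Proof.
rewrite quadratic_form_gram; apply: eq_bigr => i _; congr (_ ^+ 2).
rewrite -!mulmxA mul_diag_mx mxE mul_diag_mx !mxE.
by rewrite mulrA.
Qed.

Lemma mean_sketch_form (g : 'I_nu -> 'I_N -> bool) (x : 'cV[R]_s) :
  (x^T *m mean_sketch P U eta g *m x) 0 0 =
  nu%:R^-1 * \sum_t (x^T *m sketch P U eta (g t) *m x) 0 0.
Proof.
by rewrite -scalemxAr -scalemxAl mulmx_sumr mulmx_suml mxE summxE.
Qed.

Lemma mean_sketch_sym (g : 'I_nu -> 'I_N -> bool) :
  (mean_sketch P U eta g)^T = mean_sketch P U eta g.
Proof.
rewrite linearZ /= linear_sum /=; congr (_ *: _); apply: eq_bigr => t _.
by rewrite trmx_mul trmxK.
Qed.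

Lemma rank_mean_sketch (g : 'I_nu -> 'I_N -> bool) r :
  (forall t, \rank (sketch P U eta (g t)) <= r)%N ->
  (\rank (mean_sketch P U eta g) <= minn s (nu * r))%N.
Proof.
move=> rk; rewrite leq_min rank_leq_row /=.
rewrite /mean_sketch; apply: leq_trans (mxrank_scale _ _) _.
apply: leq_trans (mxrank_sum_le _) _.
by rewrite -[nu in (nu * r)%N]card_ord -sum_nat_const leq_sum.
Qed.

Lemma mean_sketch_posdef (g : 'I_nu -> 'I_N -> bool) (J : {set 'I_N}) :
  (0 < nu)%N -> (forall i, 0 < P i i) -> (forall i, 0 < eta i) ->
  spanning_rows U J -> J \subset sampled_indices g ->
  posdefmx (mean_sketch P U eta g).
Proof.
move=> nu0 P0 eta0 spanJ /fintype.subsetP sampled; split; first exact: mean_sketch_sym.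
move=> x; apply: contraNT; rewrite -leNgt mean_sketch_form => form_le0.
have sketch_ge0 t : 0 <= (x^T *m sketch P U eta (g t) *m x) 0 0.
  by rewrite sketch_form sumr_ge0 // => i _; exact: sqr_ge0.
(* With [0 < nu] the factor [nu%:R^-1] is positive, so the sum of nonnegative forms is also at most
   [0]. *)
have sum0 : \sum_t (x^T *m sketch P U eta (g t) *m x) 0 0 = 0.
  apply/eqP; rewrite eq_le sumr_ge0 // andbT.
  by rewrite -(pmulr_rle0 _ (_ : 0 < nu%:R^-1)) // invr_gt0 ltr0n.
apply/eqP; apply: (spanning_rows_inj spanJ) => i /sampled.
rewrite inE => /existsP[t gti].
have := psumr_eq0P (fun t _ => sketch_ge0 t) sum0 (i := t) isT.
rewrite sketch_form => /(psumr_eq0P (fun i _ => sqr_ge0 _))/(_ i isT)/eqP.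
(* Since [g t i] holds, the weight is [(Num.sqrt (eta i))^-1 * Num.sqrt (P i i)], nonzero by
   positivity; only [(U *m x) i 0 = 0] remains. *)
rewrite sqrf_eq0 gti div1r !mulf_eq0 invr_eq0.
by rewrite !sqrtr_eq0 !lt_geF //= => /eqP.
Qed.

End Sketch.

Section Events.
Context {R : realType} {d : measure_display} {Omega : measurableType d}.
Variable Pr : probability Omega R.

(** A finite Boolean family takes finitely many values, so the event is a finite union, over the
    values satisfying [Q], of finite intersections of preimages. This covers rank, singularity and
    positive definiteness alike. *)
Lemma measurable_finite_family (I : finType) (X : I -> Omega -> bool)
    (Q : (I -> bool) -> Prop) : (forall i, measurable_fun setT (X i)) ->
  measurable [set w | Q (X ^~ w)].
Proof.
move=> mX.
have -> : [set w | Q (X ^~ w)] = \bigcup_(f in [set f : {ffun I -> bool} | Q f])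
    \bigcap_(i in setT) (X i @^-1` [set f i]).
  apply/seteqP; split=> [w Qw|w [f Qf fE]].
    exists (finfun (X ^~ w)) => [|i _] /=; last by rewrite ffunE.
    by rewrite (_ : finfun _ = X ^~ w :> (I -> bool)) //; apply/funext => i; rewrite ffunE.
  by rewrite /= (_ : X ^~ w = f) //; apply/funext => i; rewrite -(fE i).
apply: fin_bigcup_measurable; first exact: finite_finset.
move=> f _; apply: fin_bigcap_measurable => [|i _]; first exact: finite_finset.
by rewrite -[_ @^-1` _]setTI; exact: mX.
Qed.

(** Singletons [A] give [p i] as the probability of [D i]. The product rule is assumed on all
    subfamilies because expanding the complements produces intersections over all of them. *)
Lemma probability_bigcap_setC (I : finType) (D : I -> set Omega) (p : I -> R)
    (B : {set I}) :
  (forall i, measurable (D i)) ->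
  (forall A : {set I},
     Pr (\bigcap_(i in [set` A]) D i) = (\prod_(i in A) p i)%:E) ->
  Pr (\bigcap_(i in [set` B]) ~` D i) = (\prod_(i in B) (1 - p i))%:E.
Proof.
move=> mD prodD.
have mcap (A : {set I}) (F : I -> set Omega) : (forall i, measurable (F i)) ->
    measurable (\bigcap_(i in [set` A]) F i).
  by move=> mF; apply: fin_bigcap_measurable => // ; exact: finite_finset.
have capU1 (a : I) (A : {set I}) (F : I -> set Omega) :
    \bigcap_(i in [set` a |: A]%SET) F i = F a `&` \bigcap_(i in [set` A]) F i.
  rewrite (_ : [set` (a |: A)%SET] = a |` [set` A]) ?bigcap_setU1 //.
  apply/seteqP; split=> i /=; rewrite !inE; first by move/predU1P.
  by move=> ?; exact/predU1P.
have cap0 (F : I -> set Omega) : \bigcap_(i in [set` finset.set0]) F i = setT.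
  rewrite (_ : [set` finset.set0] = set0) ?bigcap_set0 //.
  by apply/seteqP; split=> i //=; rewrite inE.
(* The mixed form, with some events kept and others complemented, makes the
   induction on [B] go through: [Pr (X `\` D a) = Pr X - Pr (X `&` D a)]. *)
suff disjP (A : {set I}) : [disjoint A & B]%B ->
  Pr ((\bigcap_(i in [set` A]) D i) `&` \bigcap_(i in [set` B]) ~` D i) =
  (\prod_(i in A) p i * \prod_(i in B) (1 - p i))%:E.
  have := disjP finset.set0; rewrite finset.disjoints_subset finset.sub0set => /(_ isT).
  rewrite big_set0 mul1r => <-; congr (Pr _).
  by rewrite cap0 setTI.
have [n] := ubnP #|B|; elim: n B A => // n IHn B A.
have [->|/set0Pn[a aB]] := eqVneq B finset.set0.
  by move=> _ _; rewrite cap0 setIT big_set0 mulr1 prodD.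
rewrite (cardsD1 a) aB ltnS => ltBn disjAB.
have aA : a \notin A by rewrite (disjointFl disjAB).
have disjAB' : [disjoint A & (B :\ a)%SET]%B.
  by rewrite (disjointWr _ disjAB) // subD1set.
have disjaAB' : [disjoint (a |: A)%SET & (B :\ a)%SET]%B.
  by rewrite finset.disjoints_subset finset.subUset finset.sub1set
    -finset.disjoints_subset disjAB' !inE eqxx.
rewrite -[in LHS](finset.setD1K aB) capU1 setICA setIC -setDE.
have mAB : measurable (\bigcap_(i in [set` A]) D i `&`
    \bigcap_(i in [set` (B :\ a)%SET]) ~` D i).
  by apply: measurableI; apply: mcap => // i; exact: measurableC.
rewrite measureD //; last exact: le_lt_trans (probability_le1 _ mAB) (ltry _).
(* The subtracted event is again of mixed form, with [a] moved from [B] to [A]; the induction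
   hypothesis evaluates both terms, and their difference has the common factor [1 - p a]. *)
rewrite [_ `&` D a]setIC setIA -capU1 [LHS]/=.
rewrite !IHn // big_setU1 //= (big_setD1 a aB) /= -EFinB; congr (_%:E).
by ring.
Qed.

Lemma probability_all_hit (I K : finType) (X : K * I -> Omega -> bool)
    (q : I -> R) (J : {set I}) : (forall k, measurable_fun setT (X k)) ->
  (forall k, Pr (X k @^-1` [set true]) = (q k.2)%:E) ->
  mutually_independent Pr X ->
  Pr [set w | forall i, i \in J -> exists t, X (t, i) w] =
  (\prod_(i in J) (1 - (1 - q i) ^+ #|K|))%:E.
Proof.
move=> mX PX indepX.
have mXb k b : measurable (X k @^-1` [set b]).
  by rewrite -[_ @^-1` _]setTI; exact: mX.
have PXf k : Pr (X k @^-1` [set false]) = (1 - q k.2)%:E.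
  rewrite EFinB -PX -probability_setC //; congr (Pr _).
  by apply/seteqP; split=> w /=; case: (X k w).
(* Here [D i] says that [i] is missed for every [t]; hitting all of [J] is the intersection of the
   complements. *)
rewrite -(@probability_bigcap_setC _
  (fun i => \bigcap_(t in [set: K]) X (t, i) @^-1` [set false])).
- congr (Pr _); apply/seteqP; split=> w hit i iJ.
    by move=> miss; have [t] := hit i iJ; rewrite (miss t).
  apply: contrapT => nhit; apply: (hit i iJ) => t _ /=.
  by apply/negbTE/negP => Xt; apply: nhit; exists t.
- by move=> i; apply: fin_bigcap_measurable => //; exact: finite_finset.
(* The product rule for the [D i] follows by flattening the double intersection into one over pairs,
   where independence applies directly. *)
move=> A; transitivity (Pr (\bigcap_(k in [set` [set k : K * I | k.2 \in A]%SET])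
    X k @^-1` [set false])).
  congr (Pr _); apply/seteqP; split=> w miss.
    by move=> [t i]; rewrite /= inE => iA; exact: miss.
  by move=> i iA t _; apply: miss; rewrite /= inE.
rewrite (indepX _ (fun=> [set false])) //.
rewrite (eq_bigr _ (fun k _ => PXf k)).
rewrite prodEFin; congr (_%:E).
under [RHS]eq_bigr do rewrite -prodr_const.
rewrite exchange_big pair_big_dep.
by apply: eq_bigl => k; rewrite inE.
Qed.

End Events.

Unset Implicit Arguments.
Set Strict Implicit.

Theorem proposition5p4 (R : realType) (N s nu c : nat)
    (P : 'M[R]_N) (U Uy : 'M[R]_(N, s)) (Sigma V : 'M[R]_s) (beta delta : R)
    (d : measure_display) (Omega : measurableType d) (Pr : probability Omega R)
    (gamma : 'I_nu -> 'I_N -> {RV Pr >-> bool})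
    (eta := sampling_prob U c)
    (g := fun (w : Omega) (t : 'I_nu) (i : 'I_N) => gamma t i w)
    (Yhat := fun (t : 'I_nu) (w : Omega) => sketch P U eta (g w t))
    (Ybar := fun w : Omega => mean_sketch P U eta (g w))
    (hsN : (s < N)%N) (hnu : (0 < nu)%N) (hc : (0 < c)%N)
    (hP : pos_diag_mx P)
    (hU : orthonormal_columns U)
    (heta : forall i, 0 < eta i)
    (hgamma : forall t i, Pr (gamma t i @^-1` [set true]) = (eta i)%:E)
    (hindep : mutually_independent Pr
       (fun (k : 'I_nu * 'I_N) (w : Omega) => gamma k.1 k.2 w))
    (hbeta : 0 < beta <= 1) (hdelta : 0 < delta < 1)
    (hsvd : thin_svd (sqrt_diag_mx P *m U) Uy Sigma V)
    (hxi : forall i, beta * normalized_leverage Uy i <= normalized_leverage U i)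
    (hsc : (s < c)%N)
    (hcub : c%:R < 8 * s%:R / (3 * nu%:R * beta) * ln (2 * s%:R / delta)) :
  (forall (r : nat)
      (low_rank := [set w : Omega | forall t, (\rank (Yhat t w) <= r)%N])
      (singular := [set w : Omega | Ybar w \notin unitmx]),
    (forall w, low_rank w -> (\rank (Ybar w) <= minn s (nu * r))%N) /\
    ((nu * r < s)%N ->
      Pr (low_rank `&` singular) = Pr low_rank /\
      (Pr low_rank = 1%E -> Pr singular = 1%E))) /\
  (forall J : {set 'I_N}, spanning_rows U J ->
    (forall w, J \subset sampled_indices (g w) -> posdefmx (Ybar w)) /\
    ((\prod_(i in J) (1 - (1 - eta i) ^+ nu))%:E
       <= Pr [set w | posdefmx (Ybar w)])%E /\
    1 - \sum_(i in J) (1 - eta i) ^+ nu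
      <= \prod_(i in J) (1 - (1 - eta i) ^+ nu)).
Proof.
case: hP => _ P_gt0.
have mX (k : 'I_nu * 'I_N) : measurable_fun setT (gamma k.1 k.2 : Omega -> bool).
  exact: measurable_funPT.
have mevent (Q : ('I_nu -> 'I_N -> bool) -> Prop) : measurable [set w | Q (g w)].
  exact: (@measurable_finite_family _ _ _ _
    (fun f : 'I_nu * 'I_N -> bool => Q (fun t i => f (t, i))) mX).
have eta_le1 i : eta i <= 1 by rewrite /eta /sampling_prob ge_min lexx.
split=> [r low_rank singular|J spanJ].
  have rank_le w : low_rank w -> (\rank (Ybar w) <= minn s (nu * r))%N.
    exact: rank_mean_sketch.
  split=> // nurs.
  have sub : low_rank `<=` singular.
    (* An invertible matrix would have rank [s], against the bound [nu * r < s]. *)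
    move=> w /rank_le; apply: contraTN => /mxrank_unit ->.
    by rewrite leq_min leqnn -ltnNge.
  split=> [|Plow]; first by rewrite setIidl.
  apply/eqP; rewrite eq_le probability_le1 /=; last exact: (mevent
    (fun f => mean_sketch P U eta f \notin unitmx)).
  rewrite -Plow; apply: le_measure => //; rewrite inE.
    exact: (mevent (fun f => forall t, (\rank (sketch P U eta (f t)) <= r)%N)).
  exact: (mevent (fun f => mean_sketch P U eta f \notin unitmx)).
have posdef w : J \subset sampled_indices (g w) -> posdefmx (Ybar w).
  exact: mean_sketch_posdef.
split=> //; split; last first.
  apply: prod_one_sub_ge => i; have := heta i; have := eta_le1 i => e1 e0.
  by rewrite exprn_ge0 ?subr_ge0 // exprn_ile1 ?subr_ge0 // gerBl ltW.
(* The product is the exact probability that all of [J] is sampled; this event lies inside the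
   positive definite one, and monotonicity gives the bound. *)
have := probability_all_hit J mX (fun k => hgamma k.1 k.2) hindep.
rewrite card_ord => <-.
apply: le_measure.
- rewrite inE; exact: (mevent (fun f => forall i, i \in J -> exists t, f t i)).
- rewrite inE; exact: (mevent (fun f => posdefmx (mean_sketch P U eta f))).
move=> w hit; apply: posdef; apply/fintype.subsetP => i /hit [t gti].
by rewrite inE; apply/existsP; exists t.
Qed.
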